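(* Let $n\ge1$ and let $\{\mathbf{s}_1,\dots,\mathbf{s}_M\}\subset\mathbb{R}^n$ be an arbitrary constellation of $M\ge2$ distinct points, used over the AWGN channel with maximum-likelihood detection. Then for all SNR $\gamma>0$, $$-\frac{c_n}{\gamma}\le\frac{dP_e}{d\gamma}\le0,\qquad c_n=\frac{(n/2)^{n/2}e^{-n/2}}{\Gamma(n/2)},$$ where $\Gamma$ is the gamma function, and the same bounds hold for $dP_{ei}/d\gamma$ for every $i$.
   Context: Setting: a constellation is a set of $M\ge2$ distinct points $\mathbf{s}_1,\dots,\mathbf{s}_M\in\mathbb{R}^n$, normalized by $\frac1M\sum_{i=1}^M|\mathbf{s}_i|^2=1$ ($|\cdot|$ is the Euclidean norm). The received vector is $\mathbf{r}=\mathbf{s}+\boldsymbol{\xi}$, where $\mathbf{s}$ is a random constellation point with prior probabilities $\Pr[\mathbf{s}=\mathbf{s}_i]\ge0$ summing to 1 (not depending on the noise), and $\boldsymbol\xi\sim\mathcal N(\mathbf 0,\sigma_0^2\mathbf I)$ is independent of $\mathbf{s}$; SNR $\gamma=1/\sigma_0^2>0$. The maximum-likelihood detector outputs $\hat{\mathbf{s}}=\arg\min_{\mathbf{s}_i}|\mathbf{r}-\mathbf{s}_i|$. The decision region of $\mathbf{s}_i$, with the origin shifted to $\mathbf{s}_i$, is the convex polyhedron $\Omega_i=\{\mathbf{x}\in\mathbb{R}^n:\ (\mathbf{s}_j-\mathbf{s}_i)^T\mathbf{x}\le\frac12|\mathbf{s}_j-\mathbf{s}_i|^2\ \ \forall j\ne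 i\}$. $P_{ci}(\gamma)=\int_{\Omega_i}\left(\frac{\gamma}{2\pi}\right)^{n/2}e^{-\gamma|\mathbf{x}|^2/2}\,d\mathbf{x}$, $P_{ei}=1-P_{ci}$, $P_e=\sum_{i=1}^M P_{ei}\Pr[\mathbf{s}=\mathbf{s}_i]$. *)

(* Defs.v *)
From HB Require Import structures.
From mathcomp Require Import all_boot all_order all_algebra.
From mathcomp Require Import ring lra.
From mathcomp Require Import all_classical all_reals all_analysis.

Set Implicit Arguments.
Unset Strict Implicit.
Unset Printing Implicit Defensive.

Import Order.TTheory GRing.Theory Num.Theory.
Import numFieldNormedType.Exports.

Local Open Scope classical_set_scope.
Local Open Scope ring_scope.

(* R^n is n.-tuple R, which MathComp-Analysis equips with the sigma-algebra
   generated by the coordinates, i.e. the Borel sigma-algebra. *)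

Section lebesgue_measure_on_tuples.
Context {R : realType}.

Definition tuple_cons n (p : R * n.-tuple R) : n.+1.-tuple R :=
  [tuple of p.1 :: p.2].

(* The library has Lebesgue measure on R and binary products only.  Here
   R^0 is a point of mass 1, and R^(n+1) carries the product measure of R
   and R^n, transported along (x, t) |-> x :: t.  See
   [lebesgue_tuple_box] for the values on boxes. *)
Fixpoint lebesgue_tuple (n : nat) : set (n.-tuple R) -> \bar R :=
  match n with
  | 0 => dirac [tuple]
  | n'.+1 => pushforward (@lebesgue_measure R \x @lebesgue_tuple n')%E
                         (@tuple_cons n')
  end.

Lemma measurable_tuple_cons n :
  measurable_fun [set: measurableTypeR R * n.-tuple R] (@tuple_cons n).
Proof. exact: measurable_cons. Qed.

Section successor.
Variables (n : nat) (m : {sigma_finite_measure set (n.-tuple R) -> \bar R}).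

Let mu : set (n.+1.-tuple R) -> \bar R :=
  pushforward (@lebesgue_measure R \x m)%E (@tuple_cons n).

Let mu0 : mu set0 = 0%E.
Proof. by rewrite /mu /pushforward preimage_set0 measure0. Qed.

Let mu_ge0 A : (0 <= mu A)%E.
Proof. by rewrite /mu /pushforward. Qed.

Let mu_sigma_additive : semi_sigma_additive mu.
Proof.
move=> F mF tF mUF; rewrite /mu /pushforward preimage_bigcup.
have mcF k : measurable
    (@tuple_cons n @^-1` F k : set (measurableTypeR R * n.-tuple R)).
  by rewrite -[X in measurable X]setTI; exact: measurable_tuple_cons.
apply: measure_semi_sigma_additive => //; first last.
  exact: bigcup_measurable.
apply/trivIsetP => /= i j _ _ ij; rewrite -preimage_setI.
by move/trivIsetP : tF => /(_ _ _ _ _ ij) ->//; rewrite preimage_set0.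
Qed.

HB.instance Definition _ := isMeasure.Build _ _ _ mu
  mu0 mu_ge0 mu_sigma_additive.

Let sigma_finite_mu : sigma_finite setT mu.
Proof.
have /sigma_finiteP[G [GT ndG Goo]] := sigma_finiteT (@lebesgue_measure R).
have /sigma_finiteP[H [HT ndH Hoo]] := sigma_finiteT m.
pose F k : set (measurableTypeR R * n.-tuple R) := G k `*` H k.
have FT : [set: measurableTypeR R * n.-tuple R] = \bigcup_k F k.
  apply/seteqP; split=> // -[x t] _.
  have [i _ Gx] : (\bigcup_k G k) x by rewrite -GT.
  have [j _ Ht] : (\bigcup_k H k) t by rewrite -HT.
  exists (maxn i j) => //; split.
  - by move: x Gx; exact/subsetPset/ndG/leq_maxl.
  - by move: t Ht; exact/subsetPset/ndH/leq_maxr.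
have Foo k : measurable (F k) /\ ((@lebesgue_measure R \x m) (F k) < +oo)%E.
  have [mG Gk] := Goo k; have [mH Hk] := Hoo k.
  split; first exact: measurableX.
  by rewrite product_measure1E// lte_mul_pinfty// ge0_fin_numE.
pose dec (t : n.+1.-tuple R) := (thead t, [tuple of behead t]).
have decK : cancel (@tuple_cons n) dec.
  by case=> x t; congr pair; apply/val_inj.
exists (fun k => dec @^-1` F k).
  by rewrite -preimage_bigcup -FT preimage_setT.
move=> k; have [mF Fk] := Foo k; split.
  rewrite -[X in measurable X]setTI.
  by apply: measurable_fun_pair mF => //;
    [exact: measurable_tnth|exact: measurable_behead].
rewrite /mu /pushforward (_ : _ @^-1` _ = F k)//.
by apply/seteqP; split=> p /=; rewrite decK.
Qed.

HB.instance Definition _ :=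
  Measure_isSigmaFinite.Build _ _ _ mu sigma_finite_mu.

Let successor_sigma_finite_measure :
  {sigma_finite_measure set (n.+1.-tuple R) -> \bar R} := mu.

Lemma pushforward_tuple_cons_sigma_finite :
  exists m' : {sigma_finite_measure set (n.+1.-tuple R) -> \bar R},
    pushforward (@lebesgue_measure R \x m)%E (@tuple_cons n) = m'.
Proof. by exists successor_sigma_finite_measure. Qed.

End successor.

Lemma lebesgue_tuple_sigma_finite_measure n :
  exists m : {sigma_finite_measure set (n.-tuple R) -> \bar R},
    @lebesgue_tuple n = m.
Proof.
elim: n => [|n [m mE]]; first by exists (dirac [tuple]).
have [m' m'E] := pushforward_tuple_cons_sigma_finite m.
by exists m'; rewrite /= mE.
Qed.

Section measure.
Variable n : nat.

Let lebesgue_tuple0 : @lebesgue_tuple n set0 = 0%E.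
Proof. by have [m ->] := lebesgue_tuple_sigma_finite_measure n. Qed.

Let lebesgue_tuple_ge0 A : (0 <= @lebesgue_tuple n A)%E.
Proof. by have [m ->] := lebesgue_tuple_sigma_finite_measure n. Qed.

Let lebesgue_tuple_sigma_additive : semi_sigma_additive (@lebesgue_tuple n).
Proof.
have [m ->] := lebesgue_tuple_sigma_finite_measure n.
exact: measure_semi_sigma_additive.
Qed.

HB.instance Definition _ := isMeasure.Build _ _ _ (@lebesgue_tuple n)
  lebesgue_tuple0 lebesgue_tuple_ge0 lebesgue_tuple_sigma_additive.

Let lebesgue_tuple_sigma_finite : sigma_finite setT (@lebesgue_tuple n).
Proof.
have [m ->] := lebesgue_tuple_sigma_finite_measure n.
exact: sigma_finiteT.
Qed.

HB.instance Definition _ := Measure_isSigmaFinite.Build _ _ _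
  (@lebesgue_tuple n) lebesgue_tuple_sigma_finite.

End measure.

Lemma lebesgue_tuple_box n (A : 'I_n -> set R) :
  (forall i, measurable (A i)) ->
  lebesgue_tuple [set t : n.-tuple R | forall i, A i (tnth t i)] =
  (\prod_(i < n) lebesgue_measure (A i))%E.
Proof.
elim: n A => [|n IH] A mA.
  by rewrite big_ord0 /= diracE mem_set// => -[].
have [m mE] := lebesgue_tuple_sigma_finite_measure n.
pose B := [set t : n.-tuple R | forall i, A (lift ord0 i) (tnth t i)].
have mB : measurable B.
  rewrite (_ : B = \bigcap_(i in [set: 'I_n])
      ((fun t => tnth t i) @^-1` A (lift ord0 i))).
    apply: fin_bigcap_measurable => // i _; rewrite -[X in measurable X]setTI.
    exact: measurable_tnth.
  by apply/seteqP; split=> t /= tB i; [move=> _; exact: tB|exact: tB].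
rewrite big_ord_recl /= /pushforward -IH// mE -product_measure1E//; last exact: mA.
congr (product_measure1 _ _ _); apply/seteqP; split=> -[x t] /= xtA.
- by split=> [|i]; [have := xtA ord0|have := xtA (lift ord0 i)];
    rewrite ?tnth0 ?tnthS.
- move=> i; case: (unliftP ord0 i) => [j|] ->.
  + by rewrite tnthS; apply: xtA.2.
  + by rewrite tnth0; exact: xtA.1.
Qed.

End lebesgue_measure_on_tuples.
Arguments lebesgue_tuple {R} n _.

Section awgn_error_probability.
Context {R : realType}.

Definition dot n (x y : n.-tuple R) : R := \sum_(k < n) tnth x k * tnth y k.

Definition enorm n (x : n.-tuple R) : R := Num.sqrt (dot x x).

Definition tuple_sub n (x y : n.-tuple R) : n.-tuple R :=
  [tuple tnth x k - tnth y k | k < n].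

(* M distinct points of unit average energy. *)
Definition is_constellation n M (s : 'I_M -> n.-tuple R) : Prop :=
  injective s /\ M%:R^-1 * \sum_(i < M) enorm (s i) ^+ 2 = 1.

Definition is_prior M (p : 'I_M -> R) : Prop :=
  (forall i, 0 <= p i) /\ \sum_(i < M) p i = 1.

Definition decision_region n M (s : 'I_M -> n.-tuple R) (i : 'I_M) :
    set (n.-tuple R) :=
  [set x | forall j, j != i ->
     dot (tuple_sub (s j) (s i)) x <= 2^-1 * enorm (tuple_sub (s j) (s i)) ^+ 2].

(* Density of N(0, sigma0^2 I) with sigma0^2 = 1 / g. *)
Definition noise_density n (g : R) (x : n.-tuple R) : R :=
  (g / (2 * pi)) `^ (n%:R / 2) * expR (- (g * enorm x ^+ 2 / 2)).

Definition Pc n M (s : 'I_M -> n.-tuple R) (i : 'I_M) (g : R) : R :=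
  \int[lebesgue_tuple n]_(x in decision_region s i) noise_density g x.

Definition Pei n M (s : 'I_M -> n.-tuple R) (i : 'I_M) (g : R) : R :=
  1 - Pc s i g.

Definition Pe n M (s : 'I_M -> n.-tuple R) (p : 'I_M -> R) (g : R) : R :=
  \sum_(i < M) Pei s i g * p i.

Definition Gamma (a : R) : R :=
  \int[lebesgue_measure]_(t in `]0, +oo[) (t `^ (a - 1) * expR (- t)).

Definition cn (n : nat) : R :=
  (n%:R / 2) `^ (n%:R / 2) * expR (- (n%:R / 2)) / Gamma (n%:R / 2).

Lemma enorm_sqr n (x : n.-tuple R) : enorm x ^+ 2 = dot x x.
Proof. by rewrite sqr_sqrtr// sumr_ge0// => k _; rewrite -expr2 sqr_ge0. Qed.

(* With the origin moved back from s_i, the i-th region is the set of received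
   vectors r for which s_i attains the minimum of |r - s_j|.  The regions are
   closed, so ties belong to every tied region. *)
Lemma decision_regionP n M (s : 'I_M -> n.-tuple R) i (r : n.-tuple R) :
  decision_region s i (tuple_sub r (s i)) <->
  forall j, enorm (tuple_sub r (s i)) <= enorm (tuple_sub r (s j)).
Proof.
have E j : enorm (tuple_sub r (s j)) ^+ 2 =
    enorm (tuple_sub r (s i)) ^+ 2 + enorm (tuple_sub (s j) (s i)) ^+ 2
    - 2 * dot (tuple_sub (s j) (s i)) (tuple_sub r (s i)).
  rewrite !enorm_sqr /dot mulr_sumr -big_split -sumrB /=.
  by apply: eq_bigr => k _; rewrite !tnth_mktuple; ring.
have H j : (enorm (tuple_sub r (s i)) <= enorm (tuple_sub r (s j))) =
    (dot (tuple_sub (s j) (s i)) (tuple_sub r (s i))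
     <= 2^-1 * enorm (tuple_sub (s j) (s i)) ^+ 2).
  rewrite -[LHS](@ler_pXn2r _ 2)// ?nnegrE ?sqrtr_ge0// (E j).
  move: (_ ^+ 2) (_ ^+ 2) (dot _ _) => a b c.
  by rewrite -addrA lerDl subr_ge0 mulrC -ler_pdivlMr// mulrC.
split=> [h j|h j _]; last by rewrite -H.
by have [->//|ji] := eqVneq j i; rewrite H; exact: h.
Qed.

End awgn_error_probability.

(* Main.v *)
(* With q(x) = |x|^2/2, the derivative in g of the Gaussian probability of a set D
   is (g/2pi)^(n/2) * int_D (n/(2g) - q) e^(-g q). The integrand is nonnegative
   exactly on the ball B = {q <= n/(2g)}, so among all D the derivative is largest
   for D = B. The probability of {q <= r} depends only on s = r g; comparing shells
   {s < q <= t} with their volumes, which scale as s^(n/2), shows that its derivative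
   in s is C s^(n/2-1) e^(-s). As it tends to 1 at infinity, C = 1/Gamma(n/2), and at
   s = n/2 this gives the value c_n/g for B. Conversely, rescaling x by
   sqrt(g1/g2) <= 1 shows that the probability of a set star-shaped at 0, such as a
   decision region, is nondecreasing in g. *)
Require Import Defs.
From mathcomp Require Import all_boot all_order all_algebra.
From mathcomp Require Import ring lra.
From mathcomp Require Import all_classical all_reals all_analysis.
From mathcomp Require Import measurable_realfun.

Set Implicit Arguments.
Unset Strict Implicit.
Unset Printing Implicit Defensive.

Import Order.TTheory GRing.Theory Num.Theory.
Import numFieldNormedType.Exports.

Local Open Scope classical_set_scope.
Local Open Scope ring_scope.

(** * Dilations of R^n and change of variables for Lebesgue measure *)

Definition tuple_scale (R : realType) n (c : R) (x : n.-tuple R) : n.-tuple R :=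
  [tuple c * tnth x k | k < n].

Lemma tuple_scale_cons (R : realType) n (c x : R) (t : n.-tuple R) :
  tuple_scale c (tuple_cons (x, t)) = tuple_cons (c * x, tuple_scale c t).
Proof.
apply: eq_from_tnth => i; rewrite tnth_mktuple.
by case: (unliftP ord0 i) => [j|] ->; rewrite ?tnth0 ?tnthS// tnth_mktuple.
Qed.

Lemma measurable_tuple_scale (R : realType) n (c : R) :
  measurable_fun [set: n.-tuple R] (@tuple_scale R n c).
Proof.
apply/measurable_fun_tnthP => i; rewrite (_ : _ \o _ = fun x => c * tnth x i).
  by apply: measurable_funM => //; exact: measurable_tnth.
by apply/funext => x /=; rewrite tnth_mktuple.
Qed.

(** Tonelli's theorem; it lets integrals over R^n be computed by induction on [n]. *)
Lemma ge0_integral_tuple_cons (R : realType) n (f : n.+1.-tuple R -> \bar R) :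
  measurable_fun setT f -> (forall x, (0 <= f x)%E) ->
  (\int[lebesgue_tuple n.+1]_x f x =
   \int[lebesgue_measure]_x \int[lebesgue_tuple n]_t f (tuple_cons (x, t)))%E.
Proof.
move=> mf f0.
have mc := @measurable_tuple_cons R n.
(* The two integrals are convertible; naming the pushforward exposes it to
   [ge0_integral_pushforward]. *)
transitivity (\int[pushforward (@lebesgue_measure R \x lebesgue_tuple n)%E
                (@tuple_cons R n)]_x f x)%E; first by [].
rewrite ge0_integral_pushforward//.
rewrite preimage_setT fubini_tonelli1//; last by move=> x; exact: f0.
exact: measurableT_comp.
Qed.

(** The pushforward of Lebesgue measure under x |-> c x, multiplied by c, gives ]a, b] the mass b -
    a, and these values determine Lebesgue measure. *)
Lemma ge0_integral_lebesgue_scale (R : realType) (c : R) (f : R -> \bar R) :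
  0 < c -> measurable_fun [set: measurableTypeR R] f -> (forall x, (0 <= f x)%E) ->
  (\int[lebesgue_measure]_x f (c * x)%R = c^-1%:E * \int[lebesgue_measure]_x f x)%E.
Proof.
move=> c0 mf f0.
pose phi : measurableTypeR R -> measurableTypeR R := fun x => c * x.
have mphi : measurable_fun setT phi by exact: measurable_funM.
pose m := measure_function_pushforward__canonical__measure_function_Measure
  lebesgue_measure mphi.
pose cn := NngNum (ltW c0).
transitivity (c^-1%:E * \int[mscale cn m]_x f x)%E.
  rewrite ge0_integral_mscale// ge0_integral_pushforward// preimage_setT.
  by rewrite muleA -EFinM mulVf ?gt_eqF// mul1e.
congr (_ * _)%E; apply: eq_measure_integral => /= A mA _.
apply/esym/lebesgue_measure_unique => // _ [[a b] _ <-] /=.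
rewrite /mscale/= /pushforward/= (_ : phi @^-1` _ = `]a / c, b / c]%classic).
  rewrite !lebesgue_measure_itv/= !lte_fin ltr_pM2r ?invr_gt0//.
  case: ifP => _; last by rewrite mule0.
  by rewrite -!EFinB -EFinM -mulrBl mulrCA divff ?mulr1// gt_eqF.
by apply/seteqP; split=> x /=; rewrite !in_itv/= /phi ltr_pdivrMr// ler_pdivlMr// mulrC.
Qed.

(** Induction on [n]: the inner integral over R^n gives c^-n and the first coordinate one more
    factor c^-1. *)
Lemma ge0_integral_tuple_scale (R : realType) n (c : R) (f : n.-tuple R -> \bar R) :
  0 < c -> measurable_fun setT f -> (forall x, (0 <= f x)%E) ->
  (\int[lebesgue_tuple n]_x f (tuple_scale c x) =
   (c^-1 ^+ n)%:E * \int[lebesgue_tuple n]_x f x)%E.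
Proof.
move=> c0; elim: n f => [|n IH] f mf f0.
  rewrite expr0 mul1e; apply: eq_integral => x _; congr f.
  by apply: eq_from_tnth => -[].
have ms := @measurable_tuple_scale R n.+1 c.
have mc := @measurable_tuple_cons R n.
rewrite ge0_integral_tuple_cons//; last exact: (measurableT_comp mf).
rewrite ge0_integral_tuple_cons//.
have mfc x : measurable_fun setT (fun t : n.-tuple R => f (tuple_cons (x, t))).
  apply: (measurableT_comp mf); apply: (measurableT_comp mc).
  exact: measurable_pair1.
under eq_integral => x _.
  under eq_integral => t _ do rewrite tuple_scale_cons.
  rewrite (IH (fun t => f (tuple_cons (c * x, t))))//.
  over.
have mF : measurable_fun [set: measurableTypeR R]
    (fun x => \int[lebesgue_tuple n]_t f (tuple_cons (x, t)))%E.
  apply: (@measurable_fun_fubini_tonelli_F _ _ _ _ R (lebesgue_tuple n)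
    (f \o @tuple_cons R n)); first exact: measurableT_comp.
  by move=> x; exact: f0.
have F0 x : (0 <= \int[lebesgue_tuple n]_t f (tuple_cons (x, t)))%E.
  exact: integral_ge0.
have ci0 : 0 <= c^-1 by rewrite invr_ge0 ltW.
rewrite ge0_integralZl//; last 2 first.
- by apply: (measurableT_comp mF); exact: measurable_funM.
- by rewrite lee_fin exprn_ge0.
rewrite (@ge0_integral_lebesgue_scale _ c (fun x =>
  \int[lebesgue_tuple n]_t f (tuple_cons (x, t))))%E//.
by rewrite muleA -EFinM exprSr.
Qed.

(** * Gaussian integrals over R^n *)

Definition half_sqr (R : realType) n (x : n.-tuple R) : R := dot x x / 2.

Lemma half_sqr_ge0 (R : realType) n (x : n.-tuple R) : 0 <= half_sqr x.
Proof. by rewrite divr_ge0// sumr_ge0// => k _; rewrite -expr2 sqr_ge0. Qed.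

Lemma half_sqr_scale (R : realType) n (c : R) (x : n.-tuple R) :
  half_sqr (tuple_scale c x) = c ^+ 2 * half_sqr x.
Proof.
rewrite /half_sqr /dot mulrA mulr_sumr; congr (_ / _).
by apply: eq_bigr => k _; rewrite tnth_mktuple; ring.
Qed.

Lemma measurable_dot (R : realType) n (a : n.-tuple R) :
  measurable_fun setT (dot a).
Proof.
apply: measurable_sum => k; apply: measurable_funM => //.
exact: measurable_tnth.
Qed.

Lemma measurable_half_sqr (R : realType) n :
  measurable_fun setT (@half_sqr R n).
Proof.
apply: measurable_funM => //; apply: measurable_sum => k.
by apply: measurable_funM; exact: measurable_tnth.
Qed.

Lemma measurable_gauss_tuple (R : realType) n (g : R) :
  measurable_fun [set: n.-tuple R] (fun x => expR (- (g * half_sqr x))).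
Proof.
apply: measurableT_comp => //; apply: measurableT_comp => //.
by apply: measurable_funM => //; exact: measurable_half_sqr.
Qed.

Lemma integral_gauss_scale (R : realType) (g : R) : 0 < g ->
  (\int[@lebesgue_measure R]_x (expR (- (g * (x ^+ 2 / 2))))%:E =
   (Num.sqrt (2 * pi / g))%:E)%E.
Proof.
move=> g0; set c := Num.sqrt (g / 2).
have c0 : 0 < c by rewrite sqrtr_gt0 divr_gt0.
(* [gauss_fun] is e^(-x^2), whence the factor c = sqrt (g / 2). *)
have E : (fun x : R => (expR (- (g * (x ^+ 2 / 2))))%:E) =
    (fun x => (gauss_fun (c * x))%:E).
  apply/funext => x; rewrite /gauss_fun exprMn sqr_sqrtr ?divr_ge0 ?ltW//.
  by congr ((expR _)%:E); field.
rewrite E (@ge0_integral_lebesgue_scale R c (fun x => (gauss_fun x)%:E))//.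
- rewrite integralT_gauss -EFinM; congr _%:E.
  apply: (@mulfI _ c); rewrite ?gt_eqF// mulrA divff ?gt_eqF// mul1r.
  rewrite -sqrtrM ?divr_ge0 ?ltW//; congr Num.sqrt.
  by field; rewrite gt_eqF.
- by apply/measurable_EFinP; exact: measurable_gauss_fun.
- by move=> x; rewrite lee_fin gauss_fun_ge0.
Qed.

(** The weight factors over the coordinates, so each induction step contributes one one-dimensional
    Gaussian integral. *)
Lemma integral_gauss_tuple (R : realType) n (g : R) : 0 < g ->
  (\int[lebesgue_tuple n]_x (expR (- (g * half_sqr x)))%:E =
   (Num.sqrt (2 * pi / g) ^+ n)%:E)%E.
Proof.
move=> g0; elim: n => [|n IH].
  rewrite (@integral_dirac _ _ [tuple] R setT)//.
    by rewrite diracT mul1e /half_sqr /dot big_ord0 mul0r mulr0 oppr0 expR0.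
  by apply/measurable_EFinP; exact: measurable_gauss_tuple.
rewrite ge0_integral_tuple_cons//; last first.
  by apply/measurable_EFinP; exact: measurable_gauss_tuple.
have E x : (\int[lebesgue_tuple n]_t
    (expR (- (g * half_sqr (tuple_cons (x, t)))))%:E =
    (expR (- (g * (x ^+ 2 / 2))))%:E * (Num.sqrt (2 * pi / g) ^+ n)%:E)%E.
  rewrite -IH -ge0_integralZl//; last first.
    by apply/measurable_EFinP; exact: measurable_gauss_tuple.
  apply: eq_integral => t _; rewrite -EFinM -expRD; congr ((expR _)%:E).
  rewrite /half_sqr /dot big_ord_recl tnth0.
  under eq_bigr do rewrite tnthS.
  by rewrite /=; ring.
under eq_integral do rewrite E.
rewrite ge0_integralZr//; last first.
  apply/measurable_EFinP; apply: measurableT_comp => //.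
  apply: measurableT_comp => //; apply: measurable_funM => //.
  by apply: measurable_funM => //; exact: measurable_funX.
by rewrite integral_gauss_scale// -EFinM exprS.
Qed.

Lemma integrable_gauss_tuple (R : realType) n (g : R) (D : set (n.-tuple R)) :
  0 < g -> measurable D ->
  (lebesgue_tuple n).-integrable D (fun x => (expR (- (g * half_sqr x)))%:E).
Proof.
move=> g0 mD; apply: (@integrableS _ _ _ _ setT) => //.
apply/integrableP; split; first by apply/measurable_EFinP; exact: measurable_gauss_tuple.
under eq_integral do rewrite gee0_abs ?lee_fin ?expR_ge0//.
by rewrite integral_gauss_tuple// ltry.
Qed.

(** Half of the exponent absorbs the factor q = [half_sqr x], by 1 + y <= e^y at y = g q / 2. What
    remains is a Gaussian of SNR g / 2, hence integrable. *)
Lemma half_sqr_expR_le (R : realType) n (g : R) (x : n.-tuple R) : 0 < g ->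
  half_sqr x * expR (- (g * half_sqr x)) <=
  2 / g * expR (- (g / 2 * half_sqr x)).
Proof.
move=> g0; have h0 := half_sqr_ge0 x; set h := half_sqr x in h0 *.
have -> : - (g * h) = - (g / 2 * h) + - (g / 2 * h) by field.
rewrite expRD mulrA ler_wpM2r ?expR_ge0// -ler_pdivlMr ?expR_gt0//.
rewrite -expRN opprK; have := expR_ge1Dx (g / 2 * h).
rewrite -(@ler_pM2l _ (2 / g)) ?divr_gt0//; apply: le_trans.
have -> : 2 / g * (1 + g / 2 * h) = 2 / g + h by field; rewrite gt_eqF.
by rewrite lerDr divr_ge0// ltW.
Qed.

Lemma integrable_half_sqr_gauss (R : realType) n (g : R) (D : set (n.-tuple R)) :
  0 < g -> measurable D ->
  (lebesgue_tuple n).-integrable D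
    (fun x => (half_sqr x * expR (- (g * half_sqr x)))%:E).
Proof.
move=> g0 mD.
apply: (@le_integrable _ _ _ _ _ mD _
  (fun x => (2 / g)%:E * (expR (- (g / 2 * half_sqr x)))%:E)%E).
- apply/measurable_EFinP; apply: measurable_funTS; apply: measurable_funM.
    exact: measurable_half_sqr.
  exact: measurable_gauss_tuple.
- move=> x _; rewrite -EFinM !gee0_abs ?lee_fin ?half_sqr_expR_le//.
    by rewrite mulr_ge0 ?expR_ge0// divr_ge0// ltW.
  by rewrite mulr_ge0 ?expR_ge0// half_sqr_ge0.
- by apply: integrableZl => //; apply: integrable_gauss_tuple => //; rewrite divr_gt0.
Qed.

(** * Differentiation of Gaussian probabilities in the SNR *)

Lemma is_derive_expR_linear (R : realType) (h g : R) :
  is_derive g 1 (fun z => expR (- (z * h))) (- (h * expR (- (g * h)))).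
Proof.
have H : is_derive g 1 (fun z : R => - (z * h)) (- h).
  have -> : (fun z : R => - (z * h)) = (fun z => (- h) *: z).
    by apply/funext => z; rewrite -[RHS]/(- h * z) mulNr mulrC.
  by apply: is_derive_eq; rewrite scaler1.
by apply: is_derive_eq; rewrite mulrN mulrC.
Qed.

Lemma is_derive_integral_gauss_tuple (R : realType) n (D : set (n.-tuple R)) (g : R) :
  0 < g -> measurable D ->
  is_derive g 1
    (fun g => \int[lebesgue_tuple n]_(x in D) expR (- (g * half_sqr x)))
    (- \int[lebesgue_tuple n]_(x in D) (half_sqr x * expR (- (g * half_sqr x)))).
Proof.
move=> g0 mD.
pose f z (x : n.-tuple R) : R := expR (- (z * half_sqr x)).
have f1 z x : partial1of2 f z x = - (half_sqr x * expR (- (z * half_sqr x))).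
  rewrite partial1of2E; apply: (@derive_val _ _ _ _ _ _ _ (is_derive_expR_linear _ _)).
(* Domination on this window: the absolute value of the derivative in z does not increase with z, so
   its value at g / 2 serves as the majorant [G]. *)
have Ig : (`]g / 2, 2 * g[%classic : set R) g.
  by rewrite /= in_itv/=; apply/andP; split; lra.
have I0 z : (`]g / 2, 2 * g[%classic : set R) z -> g / 2 < z.
  by rewrite /= in_itv/= => /andP[].
have intf z : (`]g / 2, 2 * g[%classic : set R) z ->
    (lebesgue_tuple n).-integrable D (EFin \o f z).
  by move=> /I0 zg; apply: integrable_gauss_tuple => //; lra.
have derf z x : (`]g / 2, 2 * g[%classic : set R) z -> D x ->
    derivable (f ^~ x) z 1.
  by move=> _ _; exact: (@ex_derive _ _ _ _ _ _ _ (is_derive_expR_linear _ _)).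
pose G (x : n.-tuple R) := half_sqr x * expR (- (g / 2 * half_sqr x)).
have G0 x : 0 <= G x by rewrite mulr_ge0 ?expR_ge0// half_sqr_ge0.
have intG : (lebesgue_tuple n).-integrable D (EFin \o G).
  by apply: integrable_half_sqr_gauss => //; lra.
have Gub z x : (`]g / 2, 2 * g[%classic : set R) z -> D x ->
    `|partial1of2 f z x| <= G x.
  move=> /I0 zg _; rewrite f1 normrN ger0_norm; last first.
    by rewrite mulr_ge0 ?expR_ge0// half_sqr_ge0.
  rewrite ler_wpM2l ?half_sqr_ge0// ler_expR lerN2 ler_wpM2r ?half_sqr_ge0//.
  exact: ltW.
apply: DeriveDef.
  exact: (derivable_under_integral mD Ig intf derf G0 intG Gub).
rewrite -derive1E.
rewrite (differentiation_under_integral mD Ig intf derf G0 intG Gub).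
rewrite -[RHS]mulN1r -RintegralZl//; last exact: integrable_half_sqr_gauss.
by apply: eq_Rintegral => x _; rewrite f1 mulN1r.
Qed.

(** For g > 0, the probability of [D] under N(0, I / g), with the normalising factor outside the
    integral so that the product rule applies. *)
Definition gauss_prob (R : realType) n (D : set (n.-tuple R)) (g : R) : R :=
  (g / (2 * pi)) `^ (n%:R / 2) *
  \int[lebesgue_tuple n]_(x in D) expR (- (g * half_sqr x)).

(** Product rule: the prefactor has logarithmic derivative n / (2 g), and differentiating the weight
    brings down minus [half_sqr]. *)
Lemma is_derive_gauss_prob (R : realType) n (D : set (n.-tuple R)) (g : R) :
  0 < g -> measurable D ->
  is_derive g 1 (gauss_prob D)
    ((g / (2 * pi)) `^ (n%:R / 2) * \int[lebesgue_tuple n]_(x in D)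
      ((n%:R / (2 * g) - half_sqr x) * expR (- (g * half_sqr x)))).
Proof.
move=> g0 mD.
have pi0 : 0 < 2 * pi :> R by rewrite mulr_gt0// pi_gt0.
have d1 : is_derive g 1 (fun g : R => (g / (2 * pi)) `^ (n%:R / 2))
   ((g / (2 * pi)) `^ (n%:R / 2) * (n%:R / (2 * g))).
  have E : (fun g : R => (g / (2 * pi)) `^ (n%:R / 2)) =
     (@powR R ^~ (n%:R / 2)) \o (fun z => (2 * pi)^-1 *: z).
    by apply/funext => z /=; rewrite -[_ *: _]/(_ * _) mulrC.
  rewrite E.
  have gp : 0 < (2 * pi)^-1 *: g by rewrite mulr_gt0// invr_gt0.
  have := @is_derive1_powR R (n%:R / 2) _ gp.
  move=> H; apply: is_derive_eq.
  rewrite -[_%:A]/(_ * 1) mulr1.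
  have -> : (2 * pi)^-1 *: g = g / (2 * pi) by exact: mulrC.
  have gn0 : g / (2 * pi) != 0 by rewrite gt_eqF ?divr_gt0.
  rewrite powRB ?gn0 ?implybT//.
  rewrite powRr1 ?divr_ge0 ?ltW//.
  move: (_ `^ _) => w; move: (2 * pi) pi0 {E gp H gn0} => p p0.
  by field; rewrite !gt_eqF.
have d2 := is_derive_integral_gauss_tuple g0 mD.
apply: is_derive_eq.
have int1 := integrable_gauss_tuple g0 mD : _.-integrable D (EFin \o _).
have int2 := integrable_half_sqr_gauss g0 mD.
have -> : \int[lebesgue_tuple n]_(x in D)
      ((n%:R / (2 * g) - half_sqr x) * expR (- (g * half_sqr x))) =
    n%:R / (2 * g) * \int[lebesgue_tuple n]_(x in D) expR (- (g * half_sqr x)) -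
    \int[lebesgue_tuple n]_(x in D) (half_sqr x * expR (- (g * half_sqr x))).
  rewrite -RintegralZl// -RintegralB//; last exact: (integrableZl mD (n%:R / (2 * g)) int1).
  by apply: eq_Rintegral => x _; rewrite mulrBl.
rewrite -[X in X + _]/(_ * _) -[X in _ + X]/(_ * _).
by ring.
Qed.

(** * Dilation of sets against rescaling of the SNR *)

Lemma measurable_preimage_scale (R : realType) n (c : R) (D : set (n.-tuple R)) :
  measurable D -> measurable (tuple_scale c @^-1` D).
Proof.
by move=> mD; rewrite -[X in measurable X]setTI; exact: measurable_tuple_scale.
Qed.

Lemma ge0_integral_tuple_scale_set (R : realType) n (c : R) (D : set (n.-tuple R))
    (f : n.-tuple R -> \bar R) :
  0 < c -> measurable D -> measurable_fun setT f -> (forall x, (0 <= f x)%E) ->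
  (\int[lebesgue_tuple n]_(x in D) f (tuple_scale c x) =
   (c^-1 ^+ n)%:E * \int[lebesgue_tuple n]_(x in tuple_scale c^-1 @^-1` D) f x)%E.
Proof.
move=> c0 mD mf f0; have mcD := measurable_preimage_scale c^-1 mD.
rewrite integral_mkcond [in RHS]integral_mkcond -ge0_integral_tuple_scale//.
- apply: eq_integral => x _; rewrite !patchE.
  have cK : tuple_scale c^-1 (tuple_scale c x) = x.
    by apply: eq_from_tnth => i; rewrite !tnth_mktuple mulKf// gt_eqF.
  suff -> : (tuple_scale c x \in tuple_scale c^-1 @^-1` D) = (x \in D) by [].
  by apply/idP/idP; rewrite !inE /= cK.
- by apply/(measurable_restrictT f) => //; exact: measurable_funTS.
- by move=> x; apply: erestrict_ge0.
Qed.

Lemma powR_sqr_half (R : realType) n (c y : R) : 0 <= c -> 0 <= y ->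
  (c ^+ 2 * y) `^ (n%:R / 2) = c ^+ n * y `^ (n%:R / 2).
Proof.
move=> c0 y0; rewrite powRM ?sqr_ge0//; congr (_ * _).
by rewrite -(powR_mulrn 2 c0) -powRrM mulrCA divff// mulr1 powR_mulrn.
Qed.

(** The preimage under division by c is the dilate c D. The Jacobian c^-n cancels against the factor
    c^n gained by the prefactor. *)
Lemma gauss_prob_scale (R : realType) n (c g : R) (D : set (n.-tuple R)) :
  0 < c -> 0 < g -> measurable D ->
  gauss_prob D (c ^+ 2 * g) = gauss_prob (tuple_scale c^-1 @^-1` D) g.
Proof.
move=> c0 g0 mD; have mcD := measurable_preimage_scale c^-1 mD.
have pi0 : 0 < 2 * pi :> R by rewrite mulr_gt0// pi_gt0.
have gpi0 : 0 <= g / (2 * pi) by rewrite ltW// divr_gt0.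
rewrite /gauss_prob -mulrA (powR_sqr_half n (ltW c0) gpi0).
rewrite /Rintegral.
have -> : (\int[lebesgue_tuple n]_(x in D) (expR (- (c ^+ 2 * g * half_sqr x)))%:E =
  \int[lebesgue_tuple n]_(x in D) (expR (- (g * half_sqr (tuple_scale c x))))%:E)%E.
  by apply: eq_integral => x _; rewrite half_sqr_scale [in RHS]mulrCA [in RHS]mulrA.
rewrite (ge0_integral_tuple_scale_set (f := fun x => (expR (- (g * half_sqr x)))%:E))//.
- rewrite fineM//=; last first.
    by apply: integrable_fin_num => //; exact: integrable_gauss_tuple.
  by rewrite mulrACA -exprMn mulfV ?gt_eqF// expr1n mul1r.
- by apply/measurable_EFinP; exact: measurable_gauss_tuple.
Qed.

Lemma gauss_prob_subset (R : realType) n (g : R) (A B : set (n.-tuple R)) :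
  0 < g -> measurable A -> measurable B -> A `<=` B ->
  gauss_prob A g <= gauss_prob B g.
Proof.
move=> g0 mA mB AB; rewrite /gauss_prob ler_wpM2l ?powR_ge0//.
rewrite /Rintegral fine_le//.
- by apply: integrable_fin_num => //; exact: integrable_gauss_tuple.
- by apply: integrable_fin_num => //; exact: integrable_gauss_tuple.
apply: ge0_subset_integral => //.
by apply: measurable_funTS; apply/measurable_EFinP; exact: measurable_gauss_tuple.
Qed.

(** For c = sqrt (g2 / g1) >= 1, the SNR g2 on D amounts to g1 on c D, and star-shapedness puts D
    inside c D. *)
Lemma gauss_prob_star_nondecreasing (R : realType) n (D : set (n.-tuple R))
    (g1 g2 : R) :
  measurable D -> (forall t x, 0 <= t <= 1 -> D x -> D (tuple_scale t x)) ->
  0 < g1 -> g1 <= g2 -> gauss_prob D g1 <= gauss_prob D g2.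
Proof.
move=> mD starD g1_gt0 g12; set c := Num.sqrt (g2 / g1).
have g20 : 0 < g2 by exact: lt_le_trans g12.
have c1 : 1 <= c.
  have q1 : 1 <= g2 / g1 by rewrite ler_pdivlMr// mul1r.
  by have := ler_wsqrtr q1; rewrite sqrtr1.
have c0 : 0 < c by exact: lt_le_trans c1.
have -> : g2 = c ^+ 2 * g1.
  by rewrite sqr_sqrtr ?divr_ge0 ?(ltW g20) ?(ltW g1_gt0)// divfK// gt_eqF.
rewrite gauss_prob_scale//.
apply: gauss_prob_subset => //; first exact: measurable_preimage_scale.
by move=> x Dx /=; apply: starD => //; rewrite invr_ge0 ltW//= invf_le1.
Qed.

(** * Balls as extremal sets *)

(** For r >= 0, the Euclidean ball of radius sqrt (2 r), indexed by the level of [half_sqr] so that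
    [r] and the SNR enter through their product. *)
Definition half_sqr_ball (R : realType) n (r : R) : set (n.-tuple R) :=
  [set x | half_sqr x <= r].
Arguments half_sqr_ball {R} n r.

Lemma measurable_half_sqr_ball (R : realType) n (r : R) :
  measurable (half_sqr_ball n r).
Proof.
rewrite (_ : half_sqr_ball n r = @half_sqr R n @^-1` `]-oo, r]%classic).
  by rewrite -[X in measurable X]setTI; exact: measurable_half_sqr.
by apply/seteqP; split => x /=; rewrite in_itv.
Qed.

Lemma preimage_scale_half_sqr_ball (R : realType) n (c r : R) : 0 < c ->
  tuple_scale c^-1 @^-1` half_sqr_ball n r = half_sqr_ball n (c ^+ 2 * r).
Proof.
move=> c0; apply/seteqP; split => x;
by rewrite /half_sqr_ball/= half_sqr_scale exprVn ler_pdivrMl// exprn_gt0.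
Qed.

Lemma gauss_prob_ball (R : realType) n (r g : R) : 0 < r -> 0 < g ->
  gauss_prob (half_sqr_ball n r) g = gauss_prob (half_sqr_ball n 1) (r * g).
Proof.
move=> r0 g0; set c := Num.sqrt r.
have c0 : 0 < c by rewrite sqrtr_gt0.
have E : r = c ^+ 2 by rewrite sqr_sqrtr// ltW.
rewrite [in RHS]E gauss_prob_scale//; last exact: measurable_half_sqr_ball.
by rewrite preimage_scale_half_sqr_ball// mulr1 -E.
Qed.

(** The SNR is traded for the size of the ball, so that increments in [s] become integrals of one
    fixed density over shells. *)
Lemma gauss_prob_unit_ball (R : realType) n (s : R) : 0 < s ->
  gauss_prob (half_sqr_ball n 1) s = gauss_prob (half_sqr_ball n s) 1.
Proof. by move=> s0; rewrite (gauss_prob_ball n s0 ltr01) mulr1. Qed.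

(* The ball is exactly where the integrand in [is_derive_gauss_prob] is
   nonnegative. *)
Lemma derive1_gauss_prob_le_ball (R : realType) n (D : set (n.-tuple R)) (g : R) :
  0 < g -> measurable D ->
  derive1 (gauss_prob D) g <=
  derive1 (gauss_prob (half_sqr_ball n (n%:R / (2 * g)))) g.
Proof.
move=> g0 mD; set B := half_sqr_ball _ _.
have mB : measurable B by exact: measurable_half_sqr_ball.
rewrite !derive1E.
rewrite (@derive_val _ _ _ _ _ _ _ (is_derive_gauss_prob g0 mD)).
rewrite (@derive_val _ _ _ _ _ _ _ (is_derive_gauss_prob g0 mB)).
rewrite ler_wpM2l ?powR_ge0//.
set f := fun x : n.-tuple R => (n%:R / (2 * g) - half_sqr x) * expR (- (g * half_sqr x)).
have intf : (lebesgue_tuple n).-integrable setT (EFin \o f).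
  have -> : EFin \o f = ((fun x => (n%:R / (2 * g))%:E * (expR (- (g * half_sqr x)))%:E) \-
      (fun x => (half_sqr x * expR (- (g * half_sqr x)))%:E))%E.
    by apply/funext => x; rewrite /f /= mulrBl.
  apply: integrableB => //; last exact: integrable_half_sqr_gauss.
  by apply: integrableZl => //; exact: integrable_gauss_tuple.
(* Both integrals are extended to the whole space, where the integrands compare pointwise. *)
rewrite Rintegral_mkcond [leRHS]Rintegral_mkcond.
apply: le_Rintegral => //.
- by rewrite -restrict_EFin; apply/integrable_restrict => //; rewrite setTI; exact: integrableS intf.
- by rewrite -restrict_EFin; apply/integrable_restrict => //; rewrite setTI; exact: integrableS intf.
(* A restricted function takes the value [point] off the set, which in [R] is 0. *)
move=> x _; rewrite !patchE -[point]/(0 : R).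
have [xB|xB] := boolP (x \in B).
  case: ifP => // _; rewrite mulr_ge0 ?expR_ge0// subr_ge0.
  by move: xB; rewrite inE.
case: ifP => // _; rewrite mulr_le0_ge0 ?expR_ge0// subr_le0 ltW// ltNge.
by apply: contra xB => xB; rewrite inE.
Qed.

(** As both two-sided derivatives exist, they are limits of right-hand difference quotients, and
    these are ordered. *)
Lemma derive1_le_right (R : realType) (f g : R -> R) (a : R) :
  derivable f a 1 -> derivable g a 1 -> f a = g a ->
  (forall x, a < x -> f x <= g x) -> derive1 f a <= derive1 g a.
Proof.
move=> df dg fga fg; rewrite !derive1E.
have sub : (0 : R)^'+ `=>` 0^'.
  by move=> A [e e0 eA]; exists e => // x xe x0; apply: eA => //=; rewrite gt_eqF.
have cvg_right (u : R -> R) : derivable u a 1 ->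
    h^-1 *: (u (h *: 1 + a) - u a) @[h --> 0^'+] --> 'D_1 u a.
  move=> du.
  have du0 : h^-1 *: (u (h *: 1 + a) - u a) @[h --> 0^'] --> 'D_1 u a by exact: du.
  by move=> A /du0; exact: sub.
apply: (ler_cvg_to (cvg_right f df) (cvg_right g dg)).
near=> h.
have h0 : 0 < h by near: h; exact: nbhs_right_gt.
rewrite ler_pM2l ?invr_gt0// fga lerD2r fg// ltrDr.
by rewrite -[_ *: _]/(_ * _) mulr1.
Unshelve. all: by end_near. Qed.

(** * Volumes of balls and the derivative of the ball probability *)

(** On the ball 1 <= e^r e^(-q) with q = [half_sqr], and the right-hand side is integrable. *)
Lemma lebesgue_half_sqr_ball_lty (R : realType) n (r : R) :
  (lebesgue_tuple n (half_sqr_ball n r) < +oo)%E.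
Proof.
have mB := @measurable_half_sqr_ball R n r.
rewrite -[X in (X < _)%E]mul1e -(@integral_cst _ _ _ (lebesgue_tuple n))//.
apply: (@le_lt_trans _ _ (\int[lebesgue_tuple n]_(x in half_sqr_ball n r)
    ((expR r)%:E * (expR (- (1 * half_sqr x)))%:E))%E).
  apply: ge0_le_integral => //.
  - apply: measurable_funTS; apply/measurable_EFinP; apply: measurable_funM => //.
    exact: measurable_gauss_tuple.
  - move=> x; rewrite /half_sqr_ball/= => xr.
    by rewrite -EFinM lee_fin -expRD -[X in X <= _]expR0 ler_expR mul1r subr_ge0.
apply: integrable_lty => //.
by apply: integrableZl => //; exact: integrable_gauss_tuple.
Qed.

Definition half_sqr_ball_volume (R : realType) n (r : R) : R :=
  fine (lebesgue_tuple n (half_sqr_ball n r)).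
Arguments half_sqr_ball_volume {R} n r.

Lemma half_sqr_ball_volumeE (R : realType) n (r : R) : 0 < r ->
  half_sqr_ball_volume n r = r `^ (n%:R / 2) * half_sqr_ball_volume n 1.
Proof.
move=> r0; set c := Num.sqrt r.
have c0 : 0 < c by rewrite sqrtr_gt0.
have E : r = c ^+ 2 * 1 by rewrite sqr_sqrtr ?mulr1// ltW.
have mB s := @measurable_half_sqr_ball R n s.
(* Integrating the constant 1 turns the change of variables into a statement on volumes. *)
have := @ge0_integral_tuple_scale_set R n c (half_sqr_ball n 1) (cst 1%E) c0
  (mB 1) (measurable_cst _) (fun=> lee01).
rewrite !integral_cst ?preimage_scale_half_sqr_ball// !mul1e -E => VE.
rewrite /half_sqr_ball_volume VE fineM//; last first.
  by rewrite ge0_fin_numE ?lebesgue_half_sqr_ball_lty.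
rewrite [in _ `^ _]E (powR_sqr_half n (ltW c0) ler01) powR1 mulr1 mulrA.
by rewrite -exprMn divff ?expr1n ?mul1r// gt_eqF.
Qed.

(** The difference is an integral over the shell s < q <= t, where e^(-q) lies between e^(-t) and
    e^(-s). *)
Lemma gauss_prob_ball_increment (R : realType) n (s t : R) : s <= t ->
  let k := (1 / (2 * pi)) `^ (n%:R / 2) in
  let dV := half_sqr_ball_volume n t - half_sqr_ball_volume n s in
  k * (expR (- t) * dV) <=
    gauss_prob (half_sqr_ball n t) 1 - gauss_prob (half_sqr_ball n s) 1 <=
  k * (expR (- s) * dV).
Proof.
move=> st; rewrite /=; set k := _ `^ _; set dV := _ - half_sqr_ball_volume n s.
have mB r := @measurable_half_sqr_ball R n r.
pose A : set (n.-tuple R) := half_sqr_ball n t `\` half_sqr_ball n s.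
have mA : measurable A by exact: measurableD.
have Bst : half_sqr_ball n s `<=` half_sqr_ball n t.
  by move=> x /= xs; exact: le_trans st.
have tE : half_sqr_ball n t = half_sqr_ball n s `|` A by rewrite setDUK.
have dsA : [disjoint half_sqr_ball n s & A].
  by apply/disj_setPS => x [? []].
have intA : (lebesgue_tuple n).-integrable A (fun x => (expR (- (1 * half_sqr x)))%:E).
  exact: integrable_gauss_tuple.
have Aoo : (lebesgue_tuple n A < +oo)%E.
  apply: le_lt_trans (lebesgue_half_sqr_ball_lty n t).
  by apply: le_measure; rewrite ?inE//; exact: subDsetl.
have intc c : (lebesgue_tuple n).-integrable A (EFin \o cst c).
  apply: measurable_bounded_integrable => //; exact: bounded_cst.
have -> : dV = fine (lebesgue_tuple n A).
  rewrite /dV /half_sqr_ball_volume {1}tE measureU//; last exact/disj_set2P.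
  by rewrite fineD ?ge0_fin_numE ?lebesgue_half_sqr_ball_lty// addrAC subrr add0r.
have -> : gauss_prob (half_sqr_ball n t) 1 - gauss_prob (half_sqr_ball n s) 1 =
    k * \int[lebesgue_tuple n]_(x in A) expR (- (1 * half_sqr x)).
  rewrite /gauss_prob -/k -mulrBr tE Rintegral_setU//.
    by rewrite addrAC subrr add0r.
  by rewrite -tE; exact: integrable_gauss_tuple.
have k0 : 0 <= k by exact: powR_ge0.
apply/andP; split; rewrite ler_wpM2l// -Rintegral_cst//; apply: le_Rintegral => //.
- exact: intc.
- by move=> x [/= xt _]; rewrite ler_expR lerN2 mul1r.
- exact: intc.
- by move=> x [_ /= /negP]; rewrite -ltNge => xs; rewrite ler_expR lerN2 mul1r ltW.
Qed.

(** Up to a constant this is the gamma density of shape n/2. The shell bounds, with volumes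
    proportional to r^(n/2), put [P] between [L] and [U] on the right of [s]; both equal [P] at [s]
    and have the claimed derivative there. *)
Lemma derive1_gauss_prob_unit_ball (R : realType) n (s : R) : 0 < s ->
  derive1 (gauss_prob (half_sqr_ball n 1)) s =
  (1 / (2 * pi)) `^ (n%:R / 2) * half_sqr_ball_volume n 1 * (n%:R / 2) *
    (s `^ (n%:R / 2 - 1) * expR (- s)).
Proof.
move=> s0; set k := _ `^ _; set v := half_sqr_ball_volume n 1.
set P := gauss_prob _.
have dP : derivable P s 1.
  by apply: ex_derive; apply: is_derive_gauss_prob => //; exact: measurable_half_sqr_ball.
have dpow := @is_derive1_powR R (n%:R / 2) _ s0.
(* As P is known to be differentiable at s, bounds on the right of s suffice. *)
pose L t := P s + k * v * (expR (- t) * (t `^ (n%:R / 2) - s `^ (n%:R / 2))).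
pose U t := P s + k * v * expR (- s) * (t `^ (n%:R / 2) - s `^ (n%:R / 2)).
have dL : is_derive s 1 L (k * v * (n%:R / 2) * (s `^ (n%:R / 2 - 1) * expR (- s))).
  apply: is_derive_eq; rewrite subrr scale0r addr0 subr0 add0r mul1r.
  by rewrite -[LHS]/(k * v * (expR (- s) * (_ * _))); ring.
have dU : is_derive s 1 U (k * v * (n%:R / 2) * (s `^ (n%:R / 2 - 1) * expR (- s))).
  apply: is_derive_eq; rewrite subr0 add0r mul1r.
  by rewrite -[LHS]/(k * v * expR (- s) * (_ * _)); ring.
have inc t : s < t -> L t <= P t <= U t.
  move=> st; have t0 := lt_trans s0 st.
  have := gauss_prob_ball_increment n (ltW st); rewrite /= -/k.
  rewrite -!gauss_prob_unit_ball// -/P (half_sqr_ball_volumeE n s0).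
  rewrite (half_sqr_ball_volumeE n t0) -/v -mulrBl.
  rewrite lerBrDl lerBlDl /L /U.
  move: (_ `^ _) (_ `^ _) => a b /andP[lo up]; apply/andP; split.
    by apply: le_trans lo; rewrite lerD2l le_eqVlt; apply/orP; left; apply/eqP; ring.
  by apply: (le_trans up); rewrite lerD2l le_eqVlt; apply/orP; left; apply/eqP; ring.
apply/eqP; rewrite eq_le; apply/andP; split.
- rewrite -[leRHS](@derive_val _ _ _ _ _ _ _ dU) -derive1E.
  apply: derive1_le_right => //; first by rewrite /U subrr mulr0 addr0.
  by move=> t /inc/andP[].
- rewrite -[leLHS](@derive_val _ _ _ _ _ _ _ dL) -derive1E.
  apply: derive1_le_right => //; first by rewrite /L subrr !mulr0 addr0.
  by move=> t /inc/andP[].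
Qed.

(** * Normalisation by the gamma function *)

(** The fundamental theorem of calculus on compact intervals increasing to ]0, +oo[, then monotone
    convergence. The point 0 is avoided because t^(n/2 - 1) e^(-t) is unbounded near it for n =
    1. *)
Lemma ge0_FTC2_0y (R : realType) (f F : R -> R) (l0 l1 : R) :
  (forall x : R, 0 < x -> 0 <= f x) ->
  (forall x : R, 0 < x -> {for x, continuous f}) ->
  (forall x : R, 0 < x -> is_derive x 1 F (f x)) ->
  F (harmonic k) @[k --> \oo] --> l0 ->
  F k.+2%:R @[k --> \oo] --> l1 ->
  (\int[lebesgue_measure]_(x in `]0%R, +oo[) (f x)%:E = (l1 - l0)%:E)%E.
Proof.
move=> f0 cf dF Fl0 Fl1.
have h0 k : 0 < harmonic k :> R by rewrite /harmonic invr_gt0.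
(* [harmonic k] is 1 / (k + 1). The right end is k + 2 so that the interval is nondegenerate already
   at k = 0. *)
pose I k : set R := `[harmonic k, k.+2%:R]%classic.
have I0 k x : I k x -> 0 < x.
  by rewrite /I/= in_itv/= => /andP[hx _]; exact: lt_le_trans hx.
have intI k : (\int[lebesgue_measure]_(x in I k) (f x)%:E =
    (F k.+2%:R - F (harmonic k))%:E)%E.
  rewrite EFinB; apply: continuous_FTC2.
  - rewrite /harmonic; apply: (@le_lt_trans _ _ 1); last by rewrite ltr1n.
    by rewrite invf_le1// ler1n.
  - apply: continuous_in_subspaceT => x; rewrite inE => /I0 x0; exact: cf.
  - have cF (x : R) : 0 < x -> {for x, continuous F}.
      by move=> /dF dFx; apply/differentiable_continuous/derivable1_diffP/ex_derive.
    split.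
    + move=> x; rewrite in_itv/= => /andP[hx _].
      by have dFx := dF _ (lt_trans (h0 k) hx); exact: ex_derive.
    + by apply: cvg_at_right_filter; exact: cF.
    + by apply: cvg_at_left_filter; exact: cF.
  - move=> x; rewrite in_itv/= => /andP[hx _].
    have dFx := dF _ (lt_trans (h0 k) hx).
    by rewrite derive1E; exact: derive_val.
have UI : \bigcup_k I k = `]0, +oo[%classic.
  apply/seteqP; split => [x [k _ /I0 x0]|x] /=; rewrite in_itv/= andbT// => x0.
  (* Large enough for both 1/x < k + 1 and x < k + 2. *)
  pose k := maxn (Num.truncn x) (Num.truncn x^-1).
  exists k => //=; rewrite /I/= in_itv/= /harmonic; apply/andP; split.
    rewrite invf_ple ?posrE// ltW// (lt_le_trans (truncnS_gt _))// ler_nat ltnS.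
    exact: leq_maxr.
  rewrite ltW// (lt_le_trans (truncnS_gt _))// ler_nat ltnS leqW//.
  exact: leq_maxl.
have mI k : measurable (I k) by exact: measurable_itv.
have mf0 : measurable_fun (`]0, +oo[%classic : set R) f.
  apply: open_continuous_measurable_fun => //.
  by move=> x; rewrite inE/= in_itv/= andbT => x0; exact: cf.
have mf k : measurable_fun (I k) (fun x => (f x)%:E).
  apply/measurable_EFinP; apply: measurable_funS mf0 => //.
  by move=> x /I0; rewrite /= in_itv/= andbT.
have ndI : {homo I : k m / (k <= m)%N >-> (k <= m)%O}.
  move=> k m km; apply/subsetPset => x; rewrite /I/= !in_itv/= => /andP[hx xk].
  apply/andP; split; last by apply: (le_trans xk); rewrite ler_nat !ltnS.
  by apply: le_trans hx; rewrite /harmonic lef_pV2 ?posrE// ler_nat ltnS.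
have := ge0_nondecreasing_set_cvg_integral (mu := lebesgue_measure) ndI mI mf
  (fun k x Ix => (f0 x (I0 k x Ix) : (0 <= (f x)%:E)%E)).
rewrite UI (eq_cvg _ _ intI) => cvgI; apply: (cvg_unique _ cvgI) => //.
apply: cvg_EFin; first exact: nearW.
exact: cvgB.
Qed.

Lemma gauss_prob_setT (R : realType) n (g : R) : 0 < g ->
  gauss_prob [set: n.-tuple R] g = 1.
Proof.
move=> g0; rewrite /gauss_prob /Rintegral integral_gauss_tuple//=.
have p0 : 0 < 2 * pi :> R by rewrite mulr_gt0// pi_gt0.
set y := g / (2 * pi); have y0 : 0 < y by rewrite divr_gt0.
have -> : 2 * pi / g = y^-1 by rewrite invf_div.
rewrite [n%:R / 2]mulrC powRrM powR12_sqrt ?(ltW y0)// powR_mulrn ?sqrtr_ge0//.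
by rewrite -exprMn -sqrtrM ?(ltW y0)// divff ?gt_eqF// sqrtr1 expr1n.
Qed.

(** The weight is at most 1. For n > 0 the bound drives the probability to 0 as [s] tends to 0. *)
Lemma gauss_prob_unit_ball_le (R : realType) n (s : R) : 0 < s ->
  gauss_prob (half_sqr_ball n 1) s <=
  s `^ (n%:R / 2) * ((1 / (2 * pi)) `^ (n%:R / 2) * half_sqr_ball_volume n 1).
Proof.
move=> s0; have p0 : 0 < 2 * pi :> R by rewrite mulr_gt0// pi_gt0.
have mB := @measurable_half_sqr_ball R n 1.
rewrite /gauss_prob mulrA -powRM ?(ltW s0) ?divr_ge0 ?(ltW p0)// mul1r.
rewrite ler_wpM2l ?powR_ge0// -[leRHS]mul1r -Rintegral_cst//.
apply: le_Rintegral => //.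
- exact: integrable_gauss_tuple.
- apply: measurable_bounded_integrable => //.
  + exact: lebesgue_half_sqr_ball_lty.
  + exact: bounded_cst.
- move=> x _; rewrite -expR0 ler_expR oppr_le0 mulr_ge0 ?half_sqr_ge0//.
  exact: ltW.
Qed.

(** With the SNR traded for size, the balls increase to the whole space and monotone convergence
    applies. *)
Lemma cvg_gauss_prob_unit_ball_y (R : realType) n :
  gauss_prob (@half_sqr_ball R n 1) k.+2%:R @[k --> \oo] --> (1 : R).
Proof.
rewrite -[X in _ --> X](@gauss_prob_setT R n 1)//.
under eq_fun do rewrite gauss_prob_unit_ball//.
apply: cvgMr => //.
apply: fine_cvg; rewrite fineK; last first.
  by apply: integrable_fin_num => //; exact: integrable_gauss_tuple.
have -> : [set: n.-tuple R] = \bigcup_k half_sqr_ball n k.+2%:R.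
  apply/seteqP; split => // x _; exists (Num.truncn (half_sqr x)) => //.
  rewrite /half_sqr_ball/= ltW// (lt_le_trans (truncnS_gt _))// ler_nat.
  exact: leqnSn.
apply: ge0_nondecreasing_set_cvg_integral.
- move=> k m km; apply/subsetPset => x; rewrite /half_sqr_ball/= => /le_trans.
  by apply; rewrite ler_nat !ltnS.
- by move=> k; exact: measurable_half_sqr_ball.
- by move=> k; apply: measurable_funTS; apply/measurable_EFinP; exact: measurable_gauss_tuple.
- by move=> k x _; rewrite lee_fin expR_ge0.
Qed.

Lemma cvg_gauss_prob_unit_ball_0 (R : realType) n : (0 < n)%N ->
  gauss_prob (@half_sqr_ball R n 1) (harmonic k) @[k --> \oo] --> (0 : R).
Proof.
move=> n0; set C := (1 / (2 * pi)) `^ (n%:R / 2) * @half_sqr_ball_volume R n 1.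
have h0 k : 0 < harmonic k :> R by rewrite /harmonic invr_gt0.
apply: (@squeeze_cvgr _ _ _ _ (cst 0) (fun k => harmonic k `^ (n%:R / 2) * C)).
- apply: nearW => k; rewrite gauss_prob_unit_ball_le// andbT.
  by rewrite mulr_ge0 ?powR_ge0// Rintegral_ge0// => x _; rewrite expR_ge0.
- exact: cvg_cst.
- rewrite -[X in _ --> X](mul0r C); apply: cvgMl.
  have n20 : 0 < n%:R / 2 :> R by rewrite divr_gt0// ltr0n.
  move/cvg_at_rightP : (powR_cvg0 n20); apply; split => //.
  exact: cvg_harmonic.
Qed.

(** The derivative found for the unit ball integrates to 1 - 0 over ]0, +oo[, which identifies its
    constant as 1 / Gamma(n/2). *)
Lemma Gamma_half_sqr_ball_volume (R : realType) n : (0 < n)%N ->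
  (1 / (2 * pi)) `^ (n%:R / 2) * half_sqr_ball_volume n 1 * (n%:R / 2) *
    Gamma (n%:R / 2) = 1 :> R.
Proof.
move=> n0; set C := _ * (n%:R / 2).
have C0 : 0 <= C.
  by rewrite !mulr_ge0 ?powR_ge0 ?fine_ge0.
pose f (t : R) := t `^ (n%:R / 2 - 1) * expR (- t).
have f0 t : 0 <= f t by rewrite mulr_ge0 ?powR_ge0 ?expR_ge0.
have := @ge0_FTC2_0y R (fun t => C * f t) (gauss_prob (half_sqr_ball n 1)) 0 1.
rewrite subr0 => FTC.
have {FTC} : (\int[lebesgue_measure]_(t in `]0%R, +oo[) (C * f t)%:E = 1%:E)%E.
  apply: FTC.
  - by move=> x _; rewrite mulr_ge0.
  - move=> x x0; apply/differentiable_continuous/derivable1_diffP.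
    have dpow := @is_derive1_powR R (n%:R / 2 - 1) _ x0.
    by apply: ex_derive.
  - move=> x x0; have dP := is_derive_gauss_prob x0 (@measurable_half_sqr_ball R n 1).
    apply: DeriveDef; first exact: ex_derive.
    by rewrite -derive1E derive1_gauss_prob_unit_ball.
  - exact: cvg_gauss_prob_unit_ball_0.
  - exact: cvg_gauss_prob_unit_ball_y.
under eq_integral do rewrite EFinM.
rewrite ge0_integralZl//; last 2 first.
- apply/measurable_EFinP; apply: measurable_funTS; apply: measurable_funM.
    exact: measurable_powR.
  by apply: measurableT_comp => //; exact: measurableT_comp.
- by move=> x _; rewrite lee_fin.
rewrite /Gamma /Rintegral -/f.
(* [Gamma] is the real part of an extended integral, so the value +oo must be excluded: its product
   with [C] would be +oo, or 0 if [C] = 0, but never 1. *)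
have : (0 <= \int[lebesgue_measure]_(x in `]0%R, +oo[) (f x)%:E)%E.
  by apply: integral_ge0 => x _; rewrite lee_fin.
case: (\int[_]_(x in _) _)%E => [r _ /=|_|//]; first by rewrite -EFinM => -[].
move: C0; rewrite le_eqVlt => /predU1P[<-|C0]; last by rewrite gt0_muley.
by rewrite mul0e => -[/eqP]; rewrite eq_sym oner_eq0.
Qed.

(** * Decision regions and error probabilities *)

Lemma measurable_decision_region (R : realType) n M (s : 'I_M -> n.-tuple R) i :
  measurable (decision_region s i).
Proof.
pose b j : R := 2^-1 * enorm (tuple_sub (s j) (s i)) ^+ 2.
rewrite (_ : decision_region s i = \bigcap_(j in [set j | j != i])
    (dot (tuple_sub (s j) (s i)) @^-1` `]-oo, b j]%classic)).
  apply: fin_bigcap_measurable => [|j _].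
    exact: finite_finset.
  rewrite -[X in measurable X]setTI.
  exact: measurable_dot.
by apply/seteqP; split => x /= xD j ji; have := xD j ji; rewrite /= in_itv.
Qed.

Lemma dot_scaler (R : realType) n (a x : n.-tuple R) (t : R) :
  dot a (tuple_scale t x) = t * dot a x.
Proof.
by rewrite /dot mulr_sumr; apply: eq_bigr => k _; rewrite tnth_mktuple mulrCA.
Qed.

(** Each defining half-space has a nonnegative right-hand side, that is, it contains the origin. *)
Lemma decision_region_star (R : realType) n M (s : 'I_M -> n.-tuple R) i t x :
  0 <= t <= 1 -> decision_region s i x -> decision_region s i (tuple_scale t x).
Proof.
move=> /andP[t0 t1] xD j ji; rewrite dot_scaler.
apply: (le_trans (ler_wpM2l t0 (xD j ji))).
by rewrite ler_piMl// mulr_ge0// sqr_ge0.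
Qed.

Lemma Pc_gauss_prob (R : realType) n M (s : 'I_M -> n.-tuple R) i (g : R) :
  0 < g -> Pc s i g = gauss_prob (decision_region s i) g.
Proof.
move=> g0; rewrite /Pc /gauss_prob -RintegralZl//.
- by apply: eq_Rintegral => x _; rewrite /noise_density enorm_sqr /half_sqr mulrA.
- exact: measurable_decision_region.
- by apply: integrable_gauss_tuple => //; exact: measurable_decision_region.
Qed.

(** The extremal ball has r = n / (2 g), so r g = n/2, and the chain rule gives r P'(n/2) = r
    (n/2)^(n/2 - 1) e^(-n/2) / Gamma(n/2) = c_n / g, with P the probability of the unit-level
    ball. *)
Lemma derive1_gauss_prob_le (R : realType) n (D : set (n.-tuple R)) (g : R) :
  (0 < n)%N -> 0 < g -> measurable D -> derive1 (gauss_prob D) g <= cn n / g.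
Proof.
move=> n0 g0 mD; apply: (le_trans (derive1_gauss_prob_le_ball g0 mD)).
set r := n%:R / (2 * g).
have nR0 : 0 < n%:R :> R by rewrite ltr0n.
have r0 : 0 < r by rewrite divr_gt0// mulr_gt0.
have rg : r * g = n%:R / 2 by rewrite /r; field; rewrite gt_eqF.
have n20 : 0 < n%:R / 2 :> R by rewrite divr_gt0.
pose P : R -> R := gauss_prob (half_sqr_ball n 1).
have dP : derivable P (r * g) 1.
  apply: ex_derive; apply: is_derive_gauss_prob; first by rewrite rg.
  exact: measurable_half_sqr_ball.
(* The ball stays frozen at the level [r] belonging to [g]; only the SNR varies. *)
have E : {near g, gauss_prob (half_sqr_ball n r) =1 P \o ( *%R r)}.
  near=> z; have z0 : 0 < z by near: z; exact: lt_nbhsr.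
  by rewrite /= gauss_prob_ball.
rewrite derive1E (near_eq_derive _ E) -derive1E derive1_comp//.
rewrite derive1_gauss_prob_unit_ball rg//.
have -> : derive1 ( *%R r) g = r.
  rewrite derive1E -[LHS]/('D_1 (fun z : R => r *: z) g) deriveZ// derive_id.
  exact: mulr1.
have G := Gamma_half_sqr_ball_volume R n0.
have Gn0 : Gamma (n%:R / 2) != 0 :> R.
  by apply/eqP => G0; move: G; rewrite G0 mulr0 => /eqP; rewrite eq_sym oner_eq0.
move/(canRL (mulfK Gn0)) : G => ->.
rewrite /cn -(mulr_powRB1 (ltW n20) n20).
set w := _ `^ _; set e := expR _; set Ga := Gamma _ in Gn0 *.
rewrite le_eqVlt; apply/orP; left; apply/eqP.
rewrite /r; field; rewrite Gn0 gt_eqF//.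
Unshelve. all: by end_near. Qed.

(** Comparison on the right of [g] with the constant [gauss_prob D g], by monotonicity in the
    SNR. *)
Lemma derive1_gauss_prob_star_ge0 (R : realType) n (D : set (n.-tuple R)) (g : R) :
  0 < g -> measurable D ->
  (forall t x, 0 <= t <= 1 -> D x -> D (tuple_scale t x)) ->
  0 <= derive1 (gauss_prob D) g.
Proof.
move=> g0 mD starD; rewrite -(derive1_cst (gauss_prob D g) g).
apply: derive1_le_right => //.
- by have := is_derive_gauss_prob g0 mD => dP; exact: ex_derive.
- by move=> x gx; apply: gauss_prob_star_nondecreasing => //; exact: ltW.
Qed.

Lemma derive1_Pei (R : realType) n M (s : 'I_M -> n.-tuple R) i (g : R) :
  (0 < n)%N -> 0 < g ->
  derivable (Pei s i) g 1 /\ - (cn n / g) <= derive1 (Pei s i) g <= 0.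
Proof.
move=> n0 g0; set D := decision_region s i.
have mD : measurable D by exact: measurable_decision_region.
have dP : is_derive g 1 (gauss_prob D) (derive1 (gauss_prob D) g).
  have := is_derive_gauss_prob g0 mD => dP.
  by apply: DeriveDef; [exact: ex_derive|rewrite derive1E].
have d1 : is_derive g 1 (fun z => 1 - gauss_prob D z) (- derive1 (gauss_prob D) g).
  by apply: is_derive_eq; rewrite add0r mul1r.
(* [Pc] agrees with [gauss_prob] at positive SNR, hence on a neighbourhood of [g]. *)
have E : {near g, (fun z => 1 - gauss_prob D z) =1 Pei s i}.
  near=> z; have z0 : 0 < z by near: z; exact: lt_nbhsr.
  by rewrite /Pei Pc_gauss_prob.
have dE : is_derive g 1 (Pei s i) (- derive1 (gauss_prob D) g).
  exact: (near_eq_is_derive E).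
split; first exact: ex_derive.
rewrite derive1E derive_val oppr_le0 lerN2 derive1_gauss_prob_le//=.
apply: derive1_gauss_prob_star_ge0 => // t x; exact: decision_region_star.
Unshelve. all: by end_near. Qed.

Theorem theorem6 (R : realType) (n M : nat) (hn : (1 <= n)%N) (hM : (2 <= M)%N)
    (s : 'I_M -> n.-tuple R) (hs : is_constellation s)
    (p : 'I_M -> R) (hp : is_prior p) (gamma : R) (hgamma : 0 < gamma) :
  (derivable (Pe s p) gamma 1 /\
     - (cn n / gamma) <= derive1 (Pe s p) gamma <= 0) /\
  (forall i : 'I_M,
     derivable (Pei s i) gamma 1 /\
     - (cn n / gamma) <= derive1 (Pei s i) gamma <= 0).
Proof.
have dPei i := derive1_Pei s i hn hgamma.
split=> //; have [p0 p1] := hp.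
have dPeip i : is_derive gamma 1 (fun g => Pei s i g * p i)
    (derive1 (Pei s i) gamma * p i).
  have dP : is_derive gamma 1 (Pei s i) (derive1 (Pei s i) gamma).
    by apply: DeriveDef; [exact: (dPei i).1|rewrite derive1E].
  by apply: is_derive_eq; rewrite scaler0 add0r mulrC.
have PeE : Pe s p = \sum_(i < M) (fun g => Pei s i g * p i).
  by apply/funext => g; rewrite fct_sumE.
have dPe : is_derive gamma 1 (Pe s p) (\sum_(i < M) derive1 (Pei s i) gamma * p i).
  by rewrite PeE; exact: is_derive_sum.
split; first exact: ex_derive.
rewrite derive1E derive_val; apply/andP; split.
  (* As the priors sum to 1, the bound is its own average over [p] and is compared term by term. *)
  rewrite -[leLHS]mulr1 -p1 mulr_sumr; apply: ler_sum => i _.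
  by have [_ /andP[lo _]] := dPei i; rewrite ler_wpM2r.
by apply: sumr_le0 => i _; have [_ /andP[_ up]] := dPei i; rewrite mulr_le0_ge0.
Qed.
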